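(* For any characteristic $p$ ($p=0$ or $p$ a prime): (i) there is an $A\in\mathrm{sub}\mathcal{S}_p$ with standard full kernel; (ii) there is an $A\in\mathrm{sub}\mathcal{S}_p$ with compact full kernel.
   Context: $\mathrm{sub}\mathcal{E}_p$ is the class of structures $A$ where $A$ is a divisible subgroup (equivalently, a $\mathbb{Q}$-subspace) of the additive group of some field $D$ of characteristic $0$, equipped with a group homomorphism $\mathrm{ex}_A:A\to R^\times$, where $R$ is some field of characteristic $p$. For finite $X\subseteq A$, $\delta(X)=\mathrm{tr.d.}(X)+\mathrm{tr.d.}(\mathrm{ex}_A(X))-\dim_{\mathbb{Q}}(X)$, where transcendence degrees are over the prime fields (computed in $D$ and $R$ respectively) and $\dim_{\mathbb{Q}}(X)$ is the dimension of the $\mathbb{Q}$-span of $X$. $\mathrm{sub}\mathcal{S}_p$ is the class of $A\in\mathrm{sub}\mathcal{E}_p$ with $\delta(X)\ge0$ for all finite $X\subseteq A$. Let $\ker_{|A}=\{a\in A:\mathrm{ex}_A(a)=1\}$. $A$ has standard kernel if for some transcendental $\pi\in D$, $\ker_{|A}=\pi\cdot\mathbb{Z}$ when $p=0$ and $\ker_{|A}=\pi\cdot\mathbb{Z}[\frac1p]$ when $p>0$, where $\mathbb{Z}[\frac1p]=\{\frac{m}{p^n}:m\in\mathbb{Z},n\in\mathbb{N}\}$. $A$ has compact kernel if $\ker_{|A}$ is an algebraically compact abelian group. $A$ has full kernel if the group $A/\ker_{|A}$ is isomorphic to a subgroup, containing all the torsion points, of the multiplicative group of an algebraically closed field of characteristic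 $p$. *)

(* Defs.v *)
From HB Require Import structures.
From mathcomp Require Import all_boot all_order all_algebra.
From mathcomp Require Import ring_quotient mpoly.
From mathcomp Require boolp.

Set Implicit Arguments.
Unset Strict Implicit.
Unset Printing Implicit Defensive.

Import GRing.Theory.
Local Open Scope ring_scope.

Definition field_char (p : nat) (F : fieldType) : Prop :=
  if p is 0%N then [pchar F] =i pred0 else p \in [pchar F].

Record subg (V : zmodType) (S : zmodClosed V) : predArgType :=
  Subg { sgval : V; _ : sgval \in S }.
HB.instance Definition _ (V : zmodType) (S : zmodClosed V) :=
  [isSub for @sgval V S].
HB.instance Definition _ (V : zmodType) (S : zmodClosed V) :=
  [Choice of subg S by <:].
HB.instance Definition _ (V : zmodType) (S : zmodClosed V) :=
  [SubChoice_isSubZmodule of subg S by <:].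

Definition divisible (V : zmodType) : Prop :=
  forall (n : nat) (x : V), (0 < n)%N -> exists y : V, y *+ n = x.

Definition pure_embedding (K G : zmodType) (i : {additive K -> G}) : Prop :=
  injective i /\
  forall (n : nat) (k : K) (g : G),
    i k = g *+ n -> exists k' : K, k = k' *+ n.

Definition direct_summand (K G : zmodType) (i : {additive K -> G}) : Prop :=
  exists C : zmodClosed G,
    (forall g : G, exists k : K, exists2 c : G, c \in C & g = i k + c) /\
    (forall k : K, i k \in C -> i k = 0).

(* Inclusions of [K] in a larger group are represented by embeddings. *)
Definition algebraically_compact (K : zmodType) : Prop :=
  forall (G : zmodType) (i : {additive K -> G}),
    pure_embedding i -> direct_summand i.

(* The intersection of all subfields of [F]. *)
Definition prime_field (F : fieldType) (x : F) : Prop :=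
  forall S : {pred F}, divring_closed S -> x \in S.

Definition alg_indep (F : fieldType) (s : seq F) : Prop :=
  forall q : {mpoly F[size s]},
    (forall m : 'X_{1.. size s}, prime_field q@_m) ->
    q.@[fun i => s`_i] = 0 -> q = 0.

Definition lin_indep_rat (F : fieldType) (s : seq F) : Prop :=
  forall c : 'I_(size s) -> rat,
    \sum_(i < size s) ratr (c i) * s`_i = 0 -> forall i, c i = 0.

(* Largest size of an independent subfamily of [s].  An independent family has
   no repetitions, so this depends only on the set of elements of [s]. *)
Definition max_indep (F : fieldType) (indep : seq F -> Prop) (s : seq F) : nat :=
  \max_(I : {set 'I_(size s)} | boolp.asbool (indep [seq s`_i | i : 'I_(size s) <- enum I]))
    #|I|.

Definition trdeg (F : fieldType) (s : seq F) : nat := max_indep (@alg_indep F) s.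

(* Meaningful for [F] of characteristic 0, where [ratr] embeds Q into [F]. *)
Definition dim_rat (F : fieldType) (s : seq F) : nat :=
  max_indep (@lin_indep_rat F) s.

Record subE (p : nat) := SubE {
  fieldD : fieldType;
  charD : field_char 0 fieldD;
  setA : zmodClosed fieldD;
  divisibleA : divisible (subg setA);
  fieldR : fieldType;
  charR : field_char p fieldR;
  exA : subg setA -> fieldR;
  exA_neq0 : forall a, exA a != 0;
  exAD : {morph exA : a b / a + b >-> a * b}
}.

Definition carrier (p : nat) (A : subE p) : zmodType := subg (setA A).

Definition delta (p : nat) (A : subE p) (X : seq (carrier A)) : int :=
  (trdeg [seq val a | a <- X])%:Z + (trdeg [seq exA a | a <- X])%:Z
  - (dim_rat [seq val a | a <- X])%:Z.

Definition subS (p : nat) (A : subE p) : Prop :=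
  forall X : seq (carrier A), 0 <= delta X.

Definition ker (p : nat) (A : subE p) : {pred carrier A} :=
  [pred a | exA a == 1].

Lemma ker_zmod_closed (p : nat) (A : subE p) : zmod_closed (@ker p A).
Proof.
have ex0 : exA (0 : carrier A) = 1.
  apply: (mulfI (exA_neq0 (0 : carrier A))).
  by rewrite -exAD addr0 mulr1.
split=> [|a b]; rewrite !inE ?ex0 // => /eqP ea /eqP eb.
by rewrite exAD ea mul1r -[exA (- b)]mul1r -eb -exAD subrr ex0 eb.
Qed.

HB.instance Definition _ (p : nat) (A : subE p) :=
  GRing.isZmodClosed.Build (carrier A) (@ker p A) (@ker_zmod_closed p A).

Definition kernel (p : nat) (A : subE p) : zmodClosed (carrier A) := @ker p A.

Definition kernel_ring (p : nat) (r : rat) : Prop :=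
  if p is 0%N then exists m : int, r = m%:~R
  else exists (m : int) (n : nat), r = m%:~R / p%:R ^+ n.

Definition standard_kernel (p : nat) (A : subE p) : Prop :=
  exists2 pi : fieldD A,
    ~ algebraicOver (ratr : rat -> fieldD A) pi &
    forall x : fieldD A,
      (exists2 a : carrier A, a \in kernel A & val a = x) <->
      (exists2 r : rat, kernel_ring p r & x = pi * ratr r).

Definition compact_kernel (p : nat) (A : subE p) : Prop :=
  algebraically_compact (subg (kernel A)).

(* The image of [f] is the subgroup of the multiplicative group of [L]; its
   torsion points are the roots of unity of [L]. *)
Definition full_kernel (p : nat) (A : subE p) : Prop :=
  exists (L : closedFieldType) (f : Quotient.quot (kernel A) -> L),
    [/\ field_char p L,
        injective f,
        forall u, f u != 0,
        {morph f : u v / u + v >-> u * v} &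
        forall (z : L) (n : nat), (0 < n)%N -> z ^+ n = 1 -> exists u, f u = z].

(* Main.v *)
Require Import Defs.
From HB Require Import structures.
From mathcomp Require Import all_boot all_order all_algebra all_field.
From mathcomp Require Import generic_quotient ring_quotient mpoly.
From mathcomp Require Import boolp classical_sets functions.
Set Implicit Arguments.
Unset Strict Implicit.
Unset Printing Implicit Defensive.
Import Order.TTheory GRing.Theory Num.Theory.
Local Open Scope ring_scope.

(** Write the multiplicative group of an algebraically closed field [L] of
    characteristic [p] additively, as [W = mulgrp L]. It is divisible, so by
    Zorn's lemma every homomorphism from a subgroup of a group [M] to [W] extends
    to [M] ([divisible_injective]). This extension property, for [W] and for the
    rationals, drives every part of the proof.

    Realizing a group inside a field. Let [U] be a torsion-free divisible group.
    The functions on the dual [{additive U -> rat}] that are polynomial on every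
    line form an integral domain: if one function is nonzero at [x] and another at
    [y], both restrict to nonzero polynomials on the line through [x] and [y]. Let
    [genfield U] be its fraction field and let [gen] send [u] to the evaluation at
    [u]. As functionals take arbitrary values on independent elements, linearly
    independent elements of [U] become algebraically independent in [genfield U].
    Hence any additive [e : U -> W] gives a structure on the image of [gen] in
    which the transcendence degree of [X] is already at least its linear
    dimension, so that [delta X >= 0], and whose kernel is that of [e]
    ([gen_subS]). The kernel is full as soon as the image of [e] contains the
    roots of unity ([gen_full_kernel]).

    Standard kernel. Take [U = rat] and [e = f], an analogue of
    [q |-> exp (2 i pi q)]: it suffices that [f 1 = 0] and that [f (1 / l)] is
    nontrivial for every prime [l] different from [p] ([root_additive]). Then [f q]
    is trivial exactly when the denominator of [q] is a power of [p], or [1] if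
    [p = 0] ([root_additive_ker]), and [f (1 / n)] generates the [n]-th roots of unity for
    [n] prime to [p] ([root_additive_torsion]).

    Compact kernel. Take for [U] the group [cover W] of all homomorphisms
    [rat -> W], with [e] the evaluation at [1]. The kernel is the group of
    homomorphisms from Q/Z to [W]. Such a group [K] is algebraically compact: if
    [i : K -> G] is pure, the pairing of [K] with Q/Z extends to a pairing of [G]
    with Q/Z, because purity makes the tensor product of [i] with Q/Z injective and
    [W] is divisible; the extended pairing is a retraction [G -> K]
    ([towers_algebraically_compact]). *)

(** * Homomorphisms into divisible groups *)

(** A homomorphism from a subgroup of [M] to [W], given by its graph. *)
Record partial_hom (M W : zmodType) (G : M -> W -> Prop) : Prop := PartialHom {
  partial_hom0 : G 0 0;
  partial_homB : forall m w m' w', G m w -> G m' w' -> G (m - m') (w - w');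
  partial_hom_fun : forall w, G 0 w -> w = 0 }.

Section PartialHomTheory.
Variables (M W : zmodType) (G : M -> W -> Prop).
Hypothesis homG : partial_hom G.

Lemma partial_homD m w m' w' : G m w -> G m' w' -> G (m + m') (w + w').
Proof.
move=> Gm Gm'; rewrite -[m']opprK -[w']opprK; apply: (partial_homB homG) => //.
by rewrite -[- m']sub0r -[- w']sub0r; apply: (partial_homB homG) => //; case: homG.
Qed.

Lemma partial_homMz m w k : G m w -> G (m *~ k) (w *~ k).
Proof.
move=> Gm; have GMn n : G (m *+ n) (w *+ n).
  by elim: n => [|n IHn]; [case: homG | rewrite !mulrS; apply: partial_homD].
case: k => n; first exact: GMn.
rewrite NegzE !mulrNz -[- (m *~ _)]sub0r -[- (w *~ _)]sub0r.
by apply: (partial_homB homG); [case: homG | exact: GMn].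
Qed.

Lemma partial_hom_inj m w w' : G m w -> G m w' -> w = w'.
Proof.
move=> Gw Gw'; apply/eqP; rewrite -subr_eq0; apply/eqP.
by apply: (partial_hom_fun homG); rewrite -(subrr m); apply: (partial_homB homG).
Qed.

(** The graph generated by [G] and the pair [(m0, w0)]. *)
Definition adjoin_hom (m0 : M) (w0 : W) m w :=
  exists x y k, [/\ G x y, m = x + m0 *~ k & w = y + w0 *~ k].

(** [G] and the assignment [m0 |-> w0] can only conflict on a multiple of [m0]
    lying in the domain of [G]. *)
Lemma adjoin_partial_hom m0 w0 :
  (forall k y, G (m0 *~ k) y -> y = w0 *~ k) -> partial_hom (adjoin_hom m0 w0).
Proof.
move=> compat; split.
- by exists 0, 0, 0; rewrite !mulr0z !addr0; split=> //; case: homG.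
- move=> m w m' w' [x [y [k [Gxy -> ->]]]] [x' [y' [k' [Gxy' -> ->]]]].
  exists (x - x'), (y - y'), (k - k'); split; first exact: (partial_homB homG).
    by rewrite mulrzBr opprD addrACA.
  by rewrite mulrzBr opprD addrACA.
- move=> w [x [y [k [Gxy /esym/eqP x0 ->]]]].
  have xE : x = m0 *~ - k by rewrite mulrNz; apply/eqP; rewrite -addr_eq0.
  rewrite xE in Gxy; by rewrite (compat _ _ Gxy) mulrNz addNr.
Qed.

(** One divides the value that is already forced on the least positive multiple
    of [m0] lying in the domain; the other multiples in the domain are multiples
    of that one. *)
Lemma partial_hom_compat m0 : divisible W ->
  exists w0, forall k y, G (m0 *~ k) y -> y = w0 *~ k.
Proof.
move=> divW; pose P n := (0 < n)%N && `[< exists y, G (m0 *+ n) y >].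
have [exP|noP] := pselect (exists n, P n); last first.
  exists 0 => k y Gky; rewrite mul0rz.
  have [k0|k0] := eqVneq k 0; first by apply: (partial_hom_fun homG); rewrite k0 in Gky.
  case: noP; exists `|k|%N; rewrite /P absz_gt0 k0; apply/asboolP.
  exists (y *~ sgz k).
  by have := partial_homMz (sgz k) Gky; rewrite -mulrzA mulrC -abszEsg.
have [n /andP[n_gt0 /asboolP[y0 Gn]] minn] := ex_minnP exP.
have [w0 w0E] := divW _ y0 n_gt0; exists w0 => k y Gky.
have kn : (k %% n)%Z = 0.
  have r_ge0 : 0 <= (k %% n)%Z by rewrite modz_ge0 // gt_eqF.
  have r_lt : (k %% n)%Z < n%:Z by rewrite ltz_pmod.
  have Gr : G (m0 *~ (k %% n)%Z) (y - y0 *~ (k %/ n)%Z).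
    rewrite /modz mulrzBr mulrC mulrzA.
    exact: (partial_homB homG) Gky (partial_homMz _ Gn).
  case: (k %% n)%Z r_ge0 r_lt Gr => // [[//|r]] _ r_lt Gr.
  suff: P r.+1 by move/minn; rewrite leqNgt -ltz_nat r_lt.
  by apply/asboolP; exists (y - y0 *~ (k %/ n)%Z).
have kE : k = n%:Z * (k %/ n)%Z by rewrite {1}(divz_eq k n) kn addr0 mulrC.
rewrite kE mulrzA -[w0 *~ n]/(w0 *+ n) w0E.
by apply: partial_hom_inj Gky _; rewrite {1}kE mulrzA; exact: partial_homMz.
Qed.

End PartialHomTheory.

(** Zorn's lemma is applied to the graphs that extend [G]; the empty set is added
    to them because it is the union of the empty chain. *)
Lemma divisible_injective (M W : zmodType) (G : M -> W -> Prop) :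
  divisible W -> partial_hom G ->
  exists f : {additive M -> W}, forall m w, G m w -> f m = w.
Proof.
move=> divW homG.
pose good (A : set (M * W)) :=
  partial_hom (fun m w => A (m, w)) /\ (forall m w, G m w -> A (m, w)).
have [A [PA maxA]] : exists A, (A = set0 \/ good A) /\
    forall B, (A `<` B)%classic -> ~ (B = set0 \/ good B).
  apply: Zorn_bigcup => F FP totF.
  have [[X [FX [m Xm]]]|noX] := pselect (exists X, F X /\ exists x, X x); last first.
    by left; rewrite -subset0 => x [X FX Xx]; apply: noX; exists X; split=> //; exists x.
  have Fgood Y y : F Y -> Y y -> good Y.
    by move=> FY Yy; case: (FP _ FY) => // Y0; rewrite Y0 in Yy.
  have [homX GX] := Fgood _ _ FX Xm.
  right; split; last by move=> x w Gx; exists X => //; apply: GX.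
  split=> [|x w x' w' [Y FY Yx] [Z FZ Zx]|w [Y FY Y0]].
  - by exists X => //; case: homX.
  - have [YZ|ZY] := totF _ _ FY FZ.
      exists Z => //; have [[_ hB _] _] := Fgood _ _ FZ Zx.
      by apply: hB => //; apply: YZ.
    exists Y => //; have [[_ hB _] _] := Fgood _ _ FY Yx.
    by apply: hB => //; apply: ZY.
  - by have [[_ _ h0] _] := Fgood _ _ FY Y0; apply: h0.
have {PA} [homA GA] : good A.
  case: PA => // A0; case: (maxA [set x | G x.1 x.2]%classic); last first.
    by right; split=> //; case: homG => h0 hB hF; split.
  rewrite A0; split=> [x []|/(_ (0, 0))]; apply; exact: partial_hom0 homG.
have total m : exists w, A (m, w).
  have [w0 compat] := partial_hom_compat homA m divW.
  have homB := adjoin_partial_hom homA compat.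
  apply: contrapT => noA.
  apply: (maxA [set x | adjoin_hom (fun a b => A (a, b)) m w0 x.1 x.2]%classic).
    split=> [[x y] Axy /=|/(_ (m, w0)) sBA]; first by exists x, y, 0; rewrite !mulr0z !addr0.
    apply: noA; exists w0; apply: sBA; exists 0, 0, 1; rewrite !mulr1z !add0r.
    by split=> //; case: homA.
  right; split; first by case: homB.
  by move=> x y Gxy /=; exists x, y, 0; rewrite !mulr0z !addr0; split=> //; apply: GA.
have [f fA] := choice total.
have fB : zmod_morphism f.
  move=> x y; apply: (partial_hom_inj homA (fA _)).
  exact: (partial_homB homA (fA x) (fA y)).
pose fM := GRing.isZmodMorphism.Build _ _ f fB.
pose f' : {additive M -> W} := HB.pack f fM.
by exists f' => m w Gm; apply: (partial_hom_inj homA (fA m)); apply: GA.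
Qed.

(** * Functions that are polynomial on lines *)

Lemma poly_rat_eq0 (p : {poly rat}) : (forall t, p.[t] = 0) -> p = 0.
Proof.
move=> p0; apply: (@roots_geq_poly_eq0 _ p [seq i%:R | i <- iota 0 (size p)]).
- by apply/allP => t _; rewrite /root p0.
- by rewrite map_inj_uniq ?iota_uniq // => i j /eqP; rewrite eqr_nat => /eqP.
- by rewrite size_map size_iota.
Qed.

Lemma digits_inj (B n : nat) (f g : nat -> nat) :
  (forall i, (i < n)%N -> (f i < B)%N) -> (forall i, (i < n)%N -> (g i < B)%N) ->
  (\sum_(i < n) f i * B ^ i = \sum_(i < n) g i * B ^ i)%N ->
  forall i, (i < n)%N -> f i = g i.
Proof.
elim: n f g => [//|n IHn] f g fB gB.
have shift (h : nat -> nat) :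
    (\sum_(i < n.+1) h i * B ^ i = (\sum_(i < n) h i.+1 * B ^ i) * B + h 0)%N.
  rewrite big_ord_recl expn0 muln1 addnC big_distrl /=; congr (_ + _)%N.
  by apply: eq_bigr => i _; rewrite expnSr mulnA.
have B_gt0 : (0 < B)%N by apply: leq_ltn_trans (fB 0 _).
rewrite !shift => fg [_|i lt_in].
  by move/(congr1 (modn^~ B)): fg; rewrite !modnMDl !modn_small ?fB ?gB.
apply: (IHn (fun j => f j.+1) (fun j => g j.+1)) => // [j jn|j jn|]; [exact: fB|exact: gB|].
move/(congr1 (divn^~ B)): fg.
by rewrite !divnMDl // ?divn_small ?fB ?gB // !addn0.
Qed.

(** Kronecker substitution: along [v i = t ^ (B ^ i)], with [B] above all
    exponents, different monomials become different powers of [t]. *)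
Lemma mpoly_sum_eq0 n (s : seq 'X_{1..n}) (c : 'X_{1..n} -> rat) :
    uniq s ->
    (forall v : 'I_n -> rat, \sum_(m <- s) c m * \prod_i v i ^+ m i = 0) ->
  forall m, m \in s -> c m = 0.
Proof.
move=> s_uniq s0 m ms; pose B := (\sum_(m <- s) mdeg m).+1.
have ltB m' (i : 'I_n) : m' \in s -> (m' i < B)%N.
  move=> m's; rewrite ltnS (big_rem m') //= mdegE (bigD1 i) //= -!addnA.
  exact: leq_addr.
pose code (m' : 'X_{1..n}) := (\sum_(i < n) m' i * B ^ i)%N.
have code_inj m' : m' \in s -> code m' = code m -> m' = m.
  move=> m's cm; apply/mnmP => i.
  pose dig (m : 'X_{1..n}) j := if insub j is Some i then m i else 0%N.
  have digE (m1 : 'X_{1..n}) (j : 'I_n) : dig m1 j = m1 j by rewrite /dig valK.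
  rewrite -!digE; apply: (@digits_inj B n) => //.
  - by move=> j jn; rewrite (digE m' (Ordinal jn)) ltB.
  - by move=> j jn; rewrite (digE m (Ordinal jn)) ltB.
  - by under eq_bigr do rewrite digE; under [RHS]eq_bigr do rewrite digE.
pose P : {poly rat} := \sum_(m <- s) c m *: 'X^(code m).
have P0 : P = 0.
  apply: poly_rat_eq0 => t; rewrite horner_sum.
  rewrite -[RHS](s0 (fun i => t ^+ (B ^ i))); apply: eq_bigr => m' _.
  rewrite hornerZ hornerXn /code expr_sum; congr (_ * _); apply: eq_bigr => i _.
  by rewrite mulnC exprM.
have := congr1 (fun p : {poly rat} => p`_(code m)) P0.
rewrite coef0 /P coef_sum (bigD1_seq m) //= big_seq_cond big1 => [|m' /andP[m's m'm]].
  by rewrite coefZ coefXn eqxx mulr1 addr0.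
rewrite coefZ coefXn; case: eqP => [e|_]; last by rewrite mulr0.
by rewrite (code_inj m') ?eqxx in m'm.
Qed.

Section PolynomialFunctions.
Variable U : zmodType.

Definition dual_line (x y : {additive U -> rat}) (t : rat) (u : U) : rat :=
  x u + t * y u.

Lemma dual_line_is_zmod_morphism x y t : zmod_morphism (dual_line x y t).
Proof. by move=> u v; rewrite /dual_line !raddfB mulrBr opprD addrACA. Qed.

HB.instance Definition _ x y t :=
  GRing.isZmodMorphism.Build U rat (dual_line x y t) (dual_line_is_zmod_morphism x y t).

(** Every polynomial in evaluations is of this kind. The restriction to lines is
    all that the absence of zero divisors needs, and it spares choosing a basis. *)
Definition poly_on_lines (h : {additive U -> rat} -> rat) : Prop :=
  forall x y, exists p : {poly rat}, forall t, h (dual_line x y t) = p.[t].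

Definition polyfun : {pred ({additive U -> rat} -> rat)} := fun h => `[< poly_on_lines h >].

Lemma polyfun_subring_closed : subring_closed polyfun.
Proof.
split=> [|f g /asboolP pf /asboolP pg|f g /asboolP pf /asboolP pg]; apply/asboolP => x y.
- by exists 1 => t; rewrite hornerC.
- have [p pE] := pf x y; have [q qE] := pg x y; exists (p - q) => t.
  by rewrite hornerD hornerN -pE -qE.
- have [p pE] := pf x y; have [q qE] := pg x y; exists (p * q) => t.
  by rewrite hornerM -pE -qE.
Qed.

HB.instance Definition _ :=
  GRing.isSubringClosed.Build _ polyfun polyfun_subring_closed.

Record polyring : predArgType :=
  PolyRing { polyval : {additive U -> rat} -> rat; _ : polyval \in polyfun }.
HB.instance Definition _ := [isSub for polyval].
HB.instance Definition _ := [Choice of polyring by <:].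
HB.instance Definition _ :=
  GRing.SubChoice_isSubComPzRing.Build _ polyfun polyring polyfun_subring_closed.

Lemma polyring_oner_neq0 : (1 : polyring) != 0.
Proof.
apply/eqP => e10; pose z : {additive U -> rat} := \0.
by have /eqP := congr1 (fun h : polyring => polyval h z) e10.
Qed.

HB.instance Definition _ := GRing.PzSemiRing_isNonZero.Build polyring
  polyring_oner_neq0.

Definition polyring_unit : {pred polyring} := fun f => `[< exists g, g * f = 1 >].
Definition polyring_inv (f : polyring) : polyring :=
  if pselect (exists g, g * f = 1) is left e then projT1 (cid e) else f.

Lemma polyring_mulVx : {in polyring_unit, left_inverse 1 polyring_inv *%R}.
Proof.
move=> f /asboolP ex; rewrite /polyring_inv; case: pselect => // e.
by case: (cid e).
Qed.

Lemma polyring_unitPl (f g : polyring) : g * f = 1 -> polyring_unit f.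
Proof. by move=> gf; apply/asboolP; exists g. Qed.

Lemma polyring_inv_out : {in [predC polyring_unit], polyring_inv =1 id}.
Proof.
move=> f /negP nu; rewrite /polyring_inv; case: pselect => // e.
by case: nu; apply/asboolP.
Qed.

HB.instance Definition _ := GRing.ComNzRing_hasMulInverse.Build polyring
  polyring_mulVx polyring_unitPl polyring_inv_out.

(** If [f] is nonzero at [x] and [g] at [y], both restrict to nonzero polynomials
    on the line through [x] and [y], and so does their product. *)
Lemma polyring_integral : GRing.integral_domain_axiom polyring.
Proof.
have nz (f : polyring) : f != 0 -> exists x, polyval f x != 0.
  move=> f0; apply: contrapT => nx; case/eqP: f0; apply/val_inj/funext => x.
  by apply/eqP/negP => /negP fx; apply: nx; exists x.
move=> f g fg0; apply/norP => -[/nz[x fx] /nz[y gy]].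
pose d : {additive U -> rat} := y \- x.
(* The line runs from [x] at parameter [0] to [y] at parameter [1]. *)
have lE0 : dual_line x d 0 = x :> (_ -> _).
  by apply/funext => u; rewrite /dual_line mul0r addr0.
have lE1 : dual_line x d 1 = y :> (_ -> _).
  by apply/funext => u; rewrite /dual_line mul1r /d /= addrC subrK.
have addE (a b : {additive U -> rat}) : a = b :> (_ -> _) -> a = b.
  case: a b => a [[aP]] [b [[bP]]] /= ab; rewrite {}ab in aP *.
  by rewrite (Prop_irrelevance aP bP).
have /asboolP/(_ x d)[p pE] := valP f; have /asboolP/(_ x d)[q qE] := valP g.
have pq0 : p * q = 0.
  apply: poly_rat_eq0 => t; rewrite hornerM -pE -qE.
  exact: (congr1 (fun h => polyval h (dual_line x d t)) fg0).
move/eqP: pq0; rewrite mulf_eq0 => /orP[] /eqP z0.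
  by move/eqP: fx; apply; rewrite -(addE _ _ lE0) [LHS]pE z0 horner0.
by move/eqP: gy; apply; rewrite -(addE _ _ lE1) [LHS]qE z0 horner0.
Qed.

HB.instance Definition _ := GRing.ComUnitRing_isIntegral.Build polyring
  polyring_integral.

End PolynomialFunctions.

(** * A field in which linear independence implies algebraic independence *)

Definition torsion_free (U : zmodType) : Prop :=
  forall (n : nat) (u : U), (0 < n)%N -> u *+ n = 0 -> u = 0.

Definition int_indep (U : zmodType) n (a : 'I_n -> U) : Prop :=
  forall k : 'I_n -> int, \sum_i a i *~ k i = 0 -> forall i, k i = 0.

Lemma divisible_numField (F : numFieldType) : divisible F.
Proof.
move=> n x n_gt0; exists (x / n%:R).
by rewrite -[LHS]mulr_natr divfK // pnatr_eq0 -lt0n.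
Qed.

(** By independence the values [c i] define a homomorphism on the subgroup that
    the [a i] generate; it extends to [U] because the rationals are divisible. *)
Lemma int_indep_separated (U : zmodType) n (a : 'I_n -> U) (c : 'I_n -> rat) :
  int_indep a -> exists x : {additive U -> rat}, forall i, x (a i) = c i.
Proof.
move=> free_a.
pose G u q := exists k : 'I_n -> int, u = \sum_i a i *~ k i /\ q = \sum_i c i *~ k i.
have homG : partial_hom G.
  split.
  - by exists (fun=> 0); split; rewrite big1 // => i _; rewrite mulr0z.
  - move=> _ _ _ _ [k [-> ->]] [l [-> ->]]; exists (fun i => k i - l i).
    by split; rewrite -sumrB; apply: eq_bigr => i _; rewrite mulrzBr.
  - move=> _ [k [/esym/free_a k0 ->]].
    by rewrite big1 // => i _; rewrite k0 mulr0z.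
have [x xG] := divisible_injective (@divisible_numField _) homG.
exists x => i; apply: xG; exists (fun j => (j == i)%:Z).
by split; rewrite (bigD1 i) //= eqxx big1 ?addr0 // => j /negbTE->.
Qed.

Lemma leq_max_indep (F : fieldType) (P Q : seq F -> Prop) (s : seq F) :
    (forall t, {subset t <= s} -> P t -> Q t) ->
  (max_indep P s <= max_indep Q s)%N.
Proof.
move=> PQ; apply/bigmax_leqP => I /asboolP PI.
rewrite /max_indep (bigD1 I) ?leq_maxl //=; apply/asboolP/PQ => //.
by move=> _ /mapP[i _ ->]; apply: mem_nth.
Qed.

Section GenericField.
Variable U : zmodType.

Definition polyeval (x : {additive U -> rat}) (f : polyring U) : rat := polyval f x.

Lemma polyeval_is_zmod_morphism x : zmod_morphism (polyeval x).
Proof. by []. Qed.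
Lemma polyeval_is_monoid_morphism x : monoid_morphism (polyeval x).
Proof. by []. Qed.
HB.instance Definition _ x :=
  GRing.isZmodMorphism.Build (polyring U) rat (polyeval x) (polyeval_is_zmod_morphism x).
HB.instance Definition _ x :=
  GRing.isMonoidMorphism.Build (polyring U) rat (polyeval x) (polyeval_is_monoid_morphism x).

Lemma polyeval_inj (f g : polyring U) : (forall x, polyeval x f = polyeval x g) -> f = g.
Proof. by move=> fg; apply/val_inj/funext. Qed.

Lemma polyconst_subproof (q : rat) : (fun=> q) \in @polyfun U.
Proof. by apply/asboolP => x y; exists q%:P => t; rewrite hornerC. Qed.
Definition polyconst (q : rat) : polyring U := PolyRing (polyconst_subproof q).

Lemma polyconst_is_zmod_morphism : zmod_morphism polyconst.
Proof. by move=> q r; apply: polyeval_inj. Qed.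
Lemma polyconst_is_monoid_morphism : monoid_morphism polyconst.
Proof. by split=> [|q r]; apply: polyeval_inj. Qed.
HB.instance Definition _ :=
  GRing.isZmodMorphism.Build rat (polyring U) polyconst polyconst_is_zmod_morphism.
HB.instance Definition _ :=
  GRing.isMonoidMorphism.Build rat (polyring U) polyconst polyconst_is_monoid_morphism.

Lemma polycoord_subproof (u : U) : (fun x : {additive U -> rat} => x u) \in @polyfun U.
Proof.
apply/asboolP => x y; exists ((x u)%:P + y u *: 'X) => t.
by rewrite hornerD hornerC hornerZ hornerX /= /dual_line mulrC.
Qed.
Definition polycoord (u : U) : polyring U := PolyRing (polycoord_subproof u).

Lemma polycoord_is_zmod_morphism : zmod_morphism polycoord.
Proof. by move=> u v; apply: polyeval_inj => x; rewrite /polyeval /= raddfB. Qed.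
HB.instance Definition _ :=
  GRing.isZmodMorphism.Build U (polyring U) polycoord polycoord_is_zmod_morphism.

Definition genfield : fieldType := {fraction polyring U}.
Definition ratgen : {rmorphism rat -> genfield} :=
  @FracField.tofrac (polyring U) \o polyconst.
Definition gen : {additive U -> genfield} :=
  @FracField.tofrac (polyring U) \o polycoord.

Lemma ratgenE : ratr =1 ratgen.
Proof. by move=> q; rewrite (fmorph_eq_rat ratgen). Qed.

Lemma char_genfield : field_char 0 genfield.
Proof.
move=> l; apply/negP => /andP[l_prime]; rewrite -(rmorph_nat ratgen) fmorph_eq0.
by rewrite pnatr_eq0 => /eqP l0; rewrite l0 in l_prime.
Qed.

Lemma prime_field_ratgen (z : genfield) : prime_field z -> exists q, z = ratgen q.
Proof.
move=> /(_ (fun z => `[< exists q, z = ratgen q >])) zP; apply/asboolP/zP.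
split=> [|_ _ /asboolP[q ->] /asboolP[r ->]|_ _ /asboolP[q ->] /asboolP[r ->]]; apply/asboolP.
- by exists 1; rewrite rmorph1.
- by exists (q - r); rewrite rmorphB.
- by exists (q / r); rewrite fmorph_div.
Qed.

(** A polynomial relation with rational coefficients among the [gen (a i)] holds
    at every functional. The values at the [a i] being arbitrary, it holds at all
    rational points, so its coefficients vanish. *)
Lemma gen_alg_indep (s : seq genfield) (a : 'I_(size s) -> U) :
  (forall i : 'I_(size s), s`_i = gen (a i)) -> int_indep a -> alg_indep s.
Proof.
move=> sE free_a q q_rat q0.
have [c cE] := choice (fun m => prime_field_ratgen (q_rat m)).
pose h := \sum_(m <- msupp q) polyconst (c m) * \prod_i polycoord (a i) ^+ m i.
have h0 : h = 0.
  apply/eqP; rewrite -tofrac_eq0 -q0 mevalE /h rmorph_sum /=; apply/eqP.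
  apply: eq_bigr => m _; rewrite rmorphM cE rmorph_prod /=; congr (_ * _).
  by apply: eq_bigr => i _; rewrite rmorphXn sE.
apply/mpolyP => m; rewrite mcoeff0.
have [ms|] := boolP (m \in msupp q); last by move/memN_msupp_eq0.
rewrite cE (@mpoly_sum_eq0 _ (msupp q) c) ?rmorph0 ?msupp_uniq // => v.
have [x xv] := int_indep_separated v free_a.
rewrite -[RHS](rmorph0 (polyeval x)) -h0 rmorph_sum; apply: eq_bigr => m' _.
rewrite rmorphM rmorph_prod /=; congr (_ * _); apply: eq_bigr => i _.
by rewrite rmorphXn -xv.
Qed.

Lemma alg_indep_gen (s : seq genfield) :
  (forall z, z \in s -> exists u, z = gen u) -> lin_indep_rat s -> alg_indep s.
Proof.
move=> s_gen free_s.
have [a aE] :=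
  choice (fun i : 'I_(size s) => s_gen _ (mem_nth 0 (ltn_ord i))).
apply: (gen_alg_indep aE) => k k0 i.
have : (k i)%:~R = 0 :> rat.
  apply: (free_s (fun i => (k i)%:~R)); rewrite -[RHS](raddf0 gen) -k0.
  rewrite raddf_sum; apply: eq_bigr => j _.
  by rewrite ratr_int aE mulrzl raddfMz.
by move/eqP; rewrite intr_eq0 => /eqP.
Qed.

Lemma dim_rat_gen (s : seq genfield) :
  (forall z, z \in s -> exists u, z = gen u) -> (dim_rat s <= trdeg s)%N.
Proof.
move=> s_gen; apply: leq_max_indep => t ts; apply: alg_indep_gen => z zt.
exact: s_gen (ts _ zt).
Qed.

Hypothesis U_tf : torsion_free U.

Lemma int_indep1 (u : U) : u != 0 -> int_indep (fun _ : 'I_1 => u).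
Proof.
move=> u0 k; rewrite big_ord1 => uk0 i; rewrite ord1.
apply/eqP/contraT; rewrite -absz_gt0 => k_gt0; case/eqP: u0.
apply: (U_tf k_gt0); rewrite -[u *+ _]/(u *~ `|k ord0|%N%:Z) abszEsg mulrC mulrzA.
by move: uk0 => ->; rewrite mul0rz.
Qed.

Lemma separating_functional (u : U) (q : rat) :
  u != 0 -> exists x : {additive U -> rat}, x u = q.
Proof.
by move=> /int_indep1/(int_indep_separated (fun=> q))[x xu]; exists x; apply: (xu ord0).
Qed.

Lemma gen_inj : injective gen.
Proof.
apply: raddf_inj => u /eqP; rewrite tofrac_eq0 => /eqP u0; apply/eqP/contraT => nz_u.
have [x xu] := separating_functional 1 nz_u.
have := congr1 (polyeval x) u0; rewrite rmorph0 /polyeval /= xu => /eqP.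
by rewrite oner_eq0.
Qed.

Lemma gen_transcendental (u : U) :
  u != 0 -> ~ algebraicOver (ratr : rat -> genfield) (gen u).
Proof.
move=> nz_u [p nz_p rt_p]; case/negP: nz_p; apply/eqP/poly_rat_eq0 => t.
have [x xu] := separating_functional t nz_u.
have p0 : (map_poly polyconst p).[polycoord u] = 0.
  apply/eqP; rewrite -tofrac_eq0 -horner_map -map_poly_comp.
  by rewrite -(eq_map_poly ratgenE).
have := congr1 (polyeval x) p0; rewrite rmorph0 -horner_map -map_poly_comp.
by rewrite (eq_map_poly (g := id)) // map_poly_id // -xu.
Qed.

End GenericField.

Arguments gen {U}.
Arguments ratgen {U}.

(** * The structure attached to an additive map into a multiplicative group *)

Section MultiplicativeGroup.
Variable L : fieldType.

(** The multiplicative group of [L], in additive notation so that the theory of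
    abelian groups applies to it. *)
Record mulgrp : predArgType := MulGrp { mulval : L; _ : mulval != 0 }.
HB.instance Definition _ := [isSub for mulval].
HB.instance Definition _ := [Choice of mulgrp by <:].

Lemma mulval_neq0 (x : mulgrp) : mulval x != 0. Proof. exact: valP x. Qed.

Definition mulgrp_zero := @MulGrp 1 (oner_neq0 L).
Definition mulgrp_opp (x : mulgrp) :=
  @MulGrp (mulval x)^-1 (invr_neq0 (mulval_neq0 x)).
Definition mulgrp_add (x y : mulgrp) :=
  @MulGrp (mulval x * mulval y) (mulf_neq0 (mulval_neq0 x) (mulval_neq0 y)).

Lemma mulgrp_addA : associative mulgrp_add.
Proof. by move=> x y z; apply: val_inj; rewrite /= mulrA. Qed.
Lemma mulgrp_addC : commutative mulgrp_add.
Proof. by move=> x y; apply: val_inj; rewrite /= mulrC. Qed.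
Lemma mulgrp_add0 : left_id mulgrp_zero mulgrp_add.
Proof. by move=> x; apply: val_inj; rewrite /= mul1r. Qed.
Lemma mulgrp_addN : left_inverse mulgrp_zero mulgrp_opp mulgrp_add.
Proof. by move=> x; apply: val_inj; rewrite /= mulVf // mulval_neq0. Qed.

HB.instance Definition _ :=
  GRing.isZmodule.Build mulgrp mulgrp_addA mulgrp_addC mulgrp_add0 mulgrp_addN.

Lemma mulval0 : mulval 0 = 1. Proof. by []. Qed.
Lemma mulvalD x y : mulval (x + y) = mulval x * mulval y. Proof. by []. Qed.
Lemma mulval_inj : injective mulval. Proof. exact: val_inj. Qed.

Lemma mulvalMn x n : mulval (x *+ n) = mulval x ^+ n.
Proof. by elim: n => // n IHn; rewrite mulrS exprS mulvalD IHn. Qed.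

Lemma mulval_eq1 x : (mulval x == 1) = (x == 0).
Proof. by rewrite -mulval0 (inj_eq mulval_inj). Qed.

End MultiplicativeGroup.

Lemma divisible_mulgrp (L : closedFieldType) : divisible (mulgrp L).
Proof.
move=> n x n_gt0.
have /closed_rootP[y] : size ('X^n - (mulval x)%:P) != 1%N.
  by rewrite size_XnsubC // eqSS -lt0n.
rewrite rootE hornerD hornerN hornerXn hornerC subr_eq0 => /eqP yn.
have y0 : y != 0.
  by apply: contraNneq (mulval_neq0 x) => y0; rewrite -yn y0 expr0n eqn0Ngt n_gt0.
by exists (MulGrp y0); apply: mulval_inj; rewrite mulvalMn.
Qed.

Section GenericStructure.
Variables (p : nat) (L : closedFieldType) (U : zmodType).
Hypotheses (charL : field_char p L) (U_tf : torsion_free U) (U_div : divisible U).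
Variable e : {additive U -> mulgrp L}.

Definition gen_image : {pred genfield U} := fun z => `[< exists u, z = gen u >].

Lemma gen_image_zmod_closed : zmod_closed gen_image.
Proof.
split=> [|_ _ /asboolP[u ->] /asboolP[v ->]]; apply/asboolP.
  by exists 0; rewrite raddf0.
by exists (u - v); rewrite raddfB.
Qed.
HB.instance Definition _ := GRing.isZmodClosed.Build _ gen_image gen_image_zmod_closed.

Lemma mem_gen_image u : gen u \in gen_image.
Proof. by apply/asboolP; exists u. Qed.

Definition to_image (u : U) : subg gen_image := Subg (mem_gen_image u).
Definition of_image (a : subg gen_image) : U :=
  projT1 (cid (elimT (asboolP _) (valP a : val a \in gen_image))).

Lemma of_imageK : cancel of_image to_image.
Proof. by move=> a; apply: val_inj; rewrite /of_image /=; case: cid => u /= ->. Qed.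

Lemma to_imageK : cancel to_image of_image.
Proof. by move=> u; apply: (gen_inj U_tf); exact: (congr1 val (of_imageK (to_image u))). Qed.

Lemma to_imageD : {morph to_image : u v / u + v}.
Proof. by move=> u v; apply: val_inj; exact: (raddfD gen). Qed.

Lemma of_imageD : {morph of_image : a b / a + b}.
Proof. by move=> a b; apply: (can_inj to_imageK); rewrite to_imageD !of_imageK. Qed.

Lemma of_imageB : {morph of_image : a b / a - b}.
Proof.
by move=> a b; apply: (addIr (of_image b)); rewrite -of_imageD !subrK.
Qed.

Lemma divisible_image : divisible (subg gen_image).
Proof.
move=> n a n_gt0; have [v vn] := U_div (of_image a) n_gt0; exists (to_image v).
rewrite -[RHS]of_imageK -vn; elim: n {vn n_gt0} => [|n IHn].
  by apply: val_inj; exact: esym (raddf0 gen).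
by rewrite !mulrS IHn to_imageD.
Qed.

Definition image_ex (a : subg gen_image) : L := mulval (e (of_image a)).

Lemma image_exD : {morph image_ex : a b / a + b >-> a * b}.
Proof. by move=> a b; rewrite /image_ex of_imageD raddfD. Qed.

Definition gen_subE : subE p :=
  SubE (char_genfield U) divisible_image charL
    (fun a => mulval_neq0 (e (of_image a))) image_exD.

(** In [genfield U] the transcendence degree of [X] is at least its linear
    dimension. *)
Lemma gen_subS : subS gen_subE.
Proof.
move=> X; rewrite /delta subr_ge0 -PoszD lez_nat.
apply: leq_trans (leq_addr _ _); apply: dim_rat_gen => _ /mapP[a _ ->].
by exists (of_image a); rewrite -[a in LHS]of_imageK.
Qed.

Lemma mem_gen_kernel (a : carrier gen_subE) :
  (a \in kernel gen_subE) = (e (of_image a) == 0).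
Proof. by rewrite -mulval_eq1. Qed.

Lemma gen_full_kernel :
    (forall (z : L) n, (0 < n)%N -> z ^+ n = 1 -> exists u, mulval (e u) = z) ->
  full_kernel gen_subE.
Proof.
move=> e_tors; pose ex (a : carrier gen_subE) : L := exA a.
have exP (a b : carrier gen_subE) :
    (ex a == ex b) = (a == b %[mod Quotient.quot (kernel gen_subE)])%qT.
  rewrite -Quotient.idealrBE mem_gen_kernel of_imageB raddfB subr_eq0.
  exact: (inj_eq (@mulval_inj _)).
exists L, (fun u => ex (repr u)); split=> //.
- by move=> u v /eqP; rewrite exP !reprK => /eqP.
- by move=> u; apply: mulval_neq0.
- move=> u v; rewrite -[RHS]image_exD; apply/eqP; rewrite exP reprK.
  by rewrite raddfD /= !reprK.
- move=> z n n_gt0 /(e_tors _ _ n_gt0)[u uz].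
  exists (\pi%qT (to_image u : carrier gen_subE)).
  rewrite -uz -[in RHS](to_imageK u); apply/eqP.
  by rewrite (exP _ (to_image u)) reprK.
Qed.

End GenericStructure.

(** * Homomorphisms from the rationals, and algebraic compactness *)

(** The values [z n = f (1 / n`!)] of a homomorphism [f] from the rationals; they
    determine [f], since every rational is an integer over a factorial. *)
Definition tower (W : zmodType) (z : nat -> W) : Prop :=
  forall n, z n.+1 *+ n.+1 = z n.

Lemma tower_le (W : zmodType) (z : nat -> W) n m : tower z -> (n <= m)%N ->
  exists d, m`! = (d * n`!)%N /\ z n = z m *+ d.
Proof.
move=> tz; elim: m => [|m IHm]; first by rewrite leqn0 => /eqP->; exists 1%N.
rewrite leq_eqVlt => /predU1P[->|/IHm[d [md zd]]]; first by exists 1%N; rewrite mul1n.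
exists (m.+1 * d)%N; rewrite factS md mulnA; split=> //.
by rewrite zd -tz mulrnA.
Qed.

Lemma rat_fact_neq0 n : (n`!%:R : rat) != 0.
Proof. by rewrite pnatr_eq0 -lt0n fact_gt0. Qed.

Lemma additive_of_tower (W : zmodType) (z : nat -> W) : divisible W -> tower z ->
  exists f : {additive rat -> W}, forall n, f n`!%:R^-1 = z n.
Proof.
move=> divW tz.
pose G (q : rat) w := exists n k, q = k%:~R / n`!%:R /\ w = z n *~ k.
have raise q w : G q w -> exists n, forall m, (n <= m)%N ->
    exists k, q = k%:~R / m`!%:R /\ w = z m *~ k.
  move=> [n [k [-> ->]]]; exists n => m /(tower_le tz)[d [md ->]].
  exists (k * d%:Z); split; last by rewrite mulrC mulrzA.
  have d0 : (d%:R : rat) != 0.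
    by apply: contraNneq (rat_fact_neq0 m) => d0; rewrite md natrM d0 mul0r.
  by rewrite md natrM intrM invfM mulrA -[d%:~R]/(d%:R) mulfK.
have homG : partial_hom G.
  split; first by exists 0%N, 0; rewrite mul0r mulr0z.
    move=> q w q' w' /raise[n nP] /raise[n' nP'].
    have [k [-> ->]] := nP _ (leq_maxl n n').
    have [k' [-> ->]] := nP' _ (leq_maxr n n').
    by exists (maxn n n'), (k - k'); rewrite intrB mulrBl mulrzBr.
  move=> w [n [k [/esym/eqP]]].
  rewrite mulf_eq0 invr_eq0 (negPf (rat_fact_neq0 n)) orbF intr_eq0.
  by move=> /eqP-> ->; rewrite mulr0z.
have [f fG] := divisible_injective divW homG.
by exists f => n; apply: fG; exists n, 1; rewrite div1r mulr1z.
Qed.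

Lemma additive_rat_fact (W : zmodType) (f : {additive rat -> W}) (q : rat) :
  exists n k, f q = f n`!%:R^-1 *~ k.
Proof.
have := denq_gt0 q; case Ed : (denq q) => [[|d]|] // _.
exists d.+1, (numq q * d`!%:Z); rewrite -raddfMz; congr (f _).
rewrite -[LHS]divq_num_den Ed -[RHS]mulrzl intrM factS natrM invfM -!mulrA; congr (_ * _).
by rewrite mulrCA mulfV ?mulr1 ?rat_fact_neq0.
Qed.

Lemma additive_rat_eq0 (W : zmodType) (f : {additive rat -> W}) :
  (forall n, f n`!%:R^-1 = 0) -> forall q, f q = 0.
Proof. by move=> f0 q; have [n [k ->]] := additive_rat_fact f q; rewrite f0 mul0rz. Qed.

Lemma tower_of_additive (W : zmodType) (f : {additive rat -> W}) :
  tower (fun n => f n`!%:R^-1).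
Proof.
move=> n; rewrite -raddfMn; congr (f _).
by rewrite -[LHS]mulr_natr factS natrM invfM -mulrA mulrCA mulVf ?mulr1 // pnatr_eq0.
Qed.

Definition additive_kernel (G K : zmodType) (r : {additive G -> K}) : {pred G} :=
  [pred g | r g == 0].

Lemma additive_kernel_zmod_closed (G K : zmodType) (r : {additive G -> K}) :
  zmod_closed (additive_kernel r).
Proof.
split=> [|g h]; rewrite !inE ?raddf0 // => /eqP rg /eqP rh.
by rewrite raddfB rg rh subr0.
Qed.

HB.instance Definition _ (G K : zmodType) (r : {additive G -> K}) :=
  GRing.isZmodClosed.Build G (additive_kernel r) (additive_kernel_zmod_closed r).

Lemma retraction_direct_summand (K G : zmodType)
    (i : {additive K -> G}) (r : {additive G -> K}) :
  cancel i r -> direct_summand i.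
Proof.
move=> iK; pose C : zmodClosed G := additive_kernel r; exists C; split=> [g|k]; last first.
  by rewrite inE iK => /eqP->; rewrite raddf0.
by exists (r g), (g - i (r g)); rewrite ?inE ?raddfB ?iK ?subrr // addrC subrK.
Qed.

(** The sum over [n <= N] of [m n *+ (N`! / n`!)], in Horner form: the sum of the
    [m n] tensored with [1 / n`!] is this element tensored with [1 / N`!]. *)
Fixpoint horner_fact (G : zmodType) (m : nat -> G) (N : nat) : G :=
  if N is n.+1 then horner_fact m n *+ n.+1 + m n.+1 else m 0%N.

Lemma horner_factB (G : zmodType) (m m' : nat -> G) N :
  horner_fact (m - m') N = horner_fact m N - horner_fact m' N.
Proof. by elim: N => //= N ->; rewrite mulrnBl opprD addrACA. Qed.

Lemma horner_fact0 (G : zmodType) (m : nat -> G) N :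
  (forall n, (n <= N)%N -> m n = 0) -> horner_fact m N = 0.
Proof.
elim: N => [|N IHN] m0 /=; first exact: m0.
by rewrite m0 // addr0 IHN ?mul0rn // => n nN; apply/m0/leqW.
Qed.

Lemma horner_fact_last (G : zmodType) (m : nat -> G) N :
  (forall n, (n < N)%N -> m n = 0) -> horner_fact m N = m N.
Proof. by case: N => //= N m0; rewrite horner_fact0 // mul0rn add0r. Qed.

(** The hypotheses say that [k |-> (ev n k)_n] identifies [K] with the towers of
    [W] starting at [0], that is with the homomorphisms from Q/Z to [W]. Finite
    sequences [m] of elements of [G] stand for the elements of the tensor product
    of [G] and Q/Z, the entry [m n] being tensored with [1 / n`!]. The relation
    [rel] is the pairing of [K] with Q/Z, transported to the tensors that come from
    [K]; it is well defined because [i] is pure. An extension of it to all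
    sequences gives for each [g] the tower of the values at [g] tensored with
    [1 / n`!], hence an element of [K]. *)
Lemma towers_algebraically_compact (K W : zmodType) (ev : nat -> {additive K -> W}) :
    divisible W ->
    (forall k, tower (ev^~ k)) -> (forall k, ev 0%N k = 0) ->
    (forall k, (forall n, ev n k = 0) -> k = 0) ->
    (forall z, tower z -> z 0%N = 0 -> exists k, forall n, ev n k = z n) ->
  algebraically_compact K.
Proof.
move=> divW ev_tower ev0 ev_inj ev_surj G i [i_inj i_pure].
pose rel (m : nat -> G) w := exists N k g,
  [/\ forall n, (N < n)%N -> m n = 0, horner_fact m N = i k + g *+ N`! & w = ev N k].
have raise m w : rel m w -> exists N, forall N', (N <= N')%N -> exists k g,
    [/\ forall n, (N' < n)%N -> m n = 0,
        horner_fact m N' = i k + g *+ N'`! & w = ev N' k].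
  (* Passing from [N] to [N + 1] multiplies [k] by [N + 1]. *)
  move=> [N [k [g [m0 mE ->]]]]; exists N => N' NN'; rewrite -(subnKC NN').
  elim: (N' - N)%N => [|d [k' [g' [m0' mE' wE']]]]; first by rewrite addn0; exists k, g.
  exists (k' *+ (N + d).+1), g'; rewrite addnS; split=> [n Nn||].
  - exact/m0'/ltnW.
  - by rewrite /= mE' m0' // addr0 mulrnDl raddfMn -mulrnA mulnC factS.
  - by rewrite wE' -ev_tower raddfMn.
have hom_rel : partial_hom rel.
  split.
  - by exists 0%N, 0, 0; rewrite !raddf0 addr0.
  - move=> m w m' w' /raise[N NP] /raise[N' NP'].
    have [k [g [m0 mE ->]]] := NP _ (leq_maxl N N').
    have [k' [g' [m0' mE' ->]]] := NP' _ (leq_maxr N N').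
    exists (maxn N N'), (k - k'), (g - g'); split=> [n Nn||]; last by rewrite raddfB.
      by rewrite -[LHS]/(m n - m' n) m0 // m0' // subr0.
    by rewrite horner_factB mE mE' raddfB mulrnBl opprD addrACA.
  - move=> w [N [k [g [_ mE ->]]]]; move: mE.
    rewrite horner_fact0 // => /esym/eqP; rewrite addr_eq0 -mulNrn => /eqP/i_pure[k' ->].
    (* Purity makes [k] a multiple of [N`!], on which [ev N] is [ev 0]. *)
    have [d [NE]] := tower_le (ev_tower k') (leq0n N).
    by rewrite raddfMn NE fact0 muln1 => <-; apply: ev0.
have [phi phiE] := divisible_injective divW hom_rel.
(* [delta n g] stands for [g] tensored with [1 / n`!]. *)
pose delta n g : nat -> G := fun n' => if n' == n then g else 0.
have deltaB n g g' : delta n (g - g') = delta n g - delta n g'.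
  by apply/funext => n'; rewrite /delta -[RHS]/(_ - _); case: eqP; rewrite ?subr0.
have delta_tower g : tower (fun n => phi (delta n g)).
  move=> n; apply/eqP; rewrite -subr_eq0 -raddfMn -raddfB; apply/eqP/phiE.
  have mE n' : (delta n.+1 g *+ n.+1 - delta n g) n' =
      (if n' == n.+1 then g *+ n.+1 else 0) - (if n' == n then g else 0).
    rewrite natmulfctE /delta -[LHS]/(_ - _); case: (n' == n.+1) => //.
    by rewrite mul0rn.
  exists n.+1, 0, 0; rewrite !raddf0 ?mul0rn addr0; split=> // [n' nn'|].
    by rewrite mE !gtn_eqF ?subr0 // ltnW.
  rewrite /= horner_fact_last => [|n' n'n]; rewrite !mE ?eqxx.
    by rewrite ltn_eqF // gtn_eqF // sub0r subr0 mulNrn addNr.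
  by rewrite !ltn_eqF ?subr0 // ltnW.
have delta0 g : phi (delta 0%N g) = 0.
  apply: phiE; exists 0%N, 0, g; rewrite !raddf0 add0r; split=> // n n_gt0.
  by rewrite /delta gtn_eqF.
have [r rE] := choice (fun g => ev_surj _ (delta_tower g) (delta0 g)).
have ev_eq k k' : (forall n, ev n k = ev n k') -> k = k'.
  move=> kk'; apply/eqP; rewrite -subr_eq0; apply/eqP/ev_inj => n.
  by rewrite raddfB kk' subrr.
have rB : zmod_morphism r.
  by move=> g h; apply: ev_eq => n; rewrite raddfB !rE deltaB raddfB.
pose rM := GRing.isZmodMorphism.Build _ _ r rB.
apply: (@retraction_direct_summand _ _ i (HB.pack_for {additive G -> K} r rM)) => k /=.
apply: ev_eq => n; rewrite rE; apply: phiE; exists n, k, 0; split=> // [n' nn'|].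
  by rewrite /delta gtn_eqF.
by rewrite horner_fact_last /delta ?eqxx ?mul0rn ?addr0 // => n' n'n; rewrite ltn_eqF.
Qed.

(** * An exponential map on the rationals *)

Lemma coprime_mulrn_eq0 (W : zmodType) (x : W) (a b : nat) :
  (0 < a)%N -> coprime a b -> x *+ a = 0 -> x *+ b = 0 -> x = 0.
Proof.
move=> a_gt0 /eqP ab xa xb; have [c _] := Bezoutl b a_gt0; rewrite ab => /dvdnP[d] dE.
have := congr1 (GRing.natmul x) dE.
by rewrite (mulnC c) (mulnC d) mulrnDr !mulrnA xa xb !mul0rn addr0.
Qed.

Section RootsOfUnity.
Variable L : closedFieldType.
Implicit Types (x : mulgrp L) (f : {additive rat -> mulgrp L}).

Lemma mulgrp_pchar_eq0 l x : l \in [pchar L] -> x *+ l = 0 -> x = 0.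
Proof.
move=> lL /(congr1 (@mulval L)); rewrite mulvalMn mulval0 => xl; apply: mulval_inj.
by apply: (fmorph_inj (pFrobenius_aut lL)); rewrite /= !pFrobenius_autE xl expr1n.
Qed.

(** A root of [1 + X + ... + X^(l-1)] is an [l]-th root of unity, and it is not [1]
    because the value of that polynomial at [1] is [l]. *)
Lemma mulgrp_prime_torsion l : prime l -> l%:R != 0 :> L ->
  exists2 x : mulgrp L, x *+ l = 0 & x != 0.
Proof.
move=> l_prime l0; pose Q : {poly L} := \poly_(i < l) 1.
have sQ : size Q = l.
  by rewrite size_poly_eq ?oner_neq0.
have /closed_rootP[r] : size Q != 1%N by rewrite sQ gtn_eqF // prime_gt1.
rewrite rootE horner_poly; under eq_bigr do rewrite mul1r.
move=> /eqP rQ; have rl : r ^+ l = 1 by apply/eqP; rewrite -subr_eq0 subrX1 rQ mulr0.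
have r0 : r != 0.
  by apply: contra_eq_neq rl => ->; rewrite expr0n gtn_eqF ?prime_gt0 // eq_sym oner_neq0.
exists (MulGrp r0); first by apply: mulval_inj; rewrite mulvalMn.
apply: contraNneq l0 => /(congr1 (@mulval L)) /= r1.
by rewrite -rQ r1 (eq_bigr (fun=> 1)) ?sumr_const ?card_ord // => i _; rewrite expr1n.
Qed.

(** If [n + 1] is prime and the chosen division by [n + 1] fails the second
    condition, add to it an element of order [n + 1], which [n`!] does not kill. *)
Lemma root_tower : exists2 z : nat -> mulgrp L, tower z /\ z 0%N = 0 &
  forall n, prime n.+1 -> n.+1%:R != 0 :> L -> z n.+1 *+ n`! != 0.
Proof.
have step (nz : nat * mulgrp L) : exists y, y *+ nz.1.+1 = nz.2 /\
    (prime nz.1.+1 -> nz.1.+1%:R != 0 :> L -> y *+ nz.1`! != 0).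
  case: nz => n z /=; have [y yz] := divisible_mulgrp z (ltn0Sn n).
  have [y0|] := eqVneq (y *+ n`!) 0; last by exists y.
  have [n_prime|n_comp] := boolP (prime n.+1); last by exists y.
  have [n0|n0] := eqVneq (n.+1%:R : L) 0; first by exists y.
  have [w wn nz_w] := mulgrp_prime_torsion n_prime n0.
  exists (y + w); split=> [|_ _]; first by rewrite mulrnDl yz wn addr0.
  rewrite mulrnDl y0 add0r; apply: contraNneq nz_w => wf; apply/eqP.
  apply: (coprime_mulrn_eq0 (ltn0Sn n) _ wn wf).
  rewrite prime_coprime //; apply/negP => nf.
  have := Wilson (prime_gt1 n_prime).
  by rewrite n_prime -(addn1 n`!) dvdn_addr // dvdn1 gtn_eqF // prime_gt1.
have [s sP] := choice step.
pose z := fix z n := if n is m.+1 then s (m, z m) else 0.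
exists z => [|n]; last by case: (sP (n, z n)).
by split=> // n; case: (sP (n, z n)).
Qed.

Lemma root_additive : exists2 f : {additive rat -> mulgrp L}, f 1 = 0 &
  forall l, prime l -> l%:R != 0 :> L -> f l%:R^-1 != 0.
Proof.
have [z [tz z0] zP] := root_tower.
have [f fz] := additive_of_tower (@divisible_mulgrp L) tz.
exists f => [|[|n] // n_prime n0]; first by rewrite -z0 -fz fact0 invr1.
apply: contraNneq (zP n n_prime n0) => fn; apply/eqP.
rewrite -fz -raddfMn -{}fn; congr (f _).
by rewrite -[LHS]mulr_natr factS natrM invfM -mulrA mulVf ?mulr1 ?rat_fact_neq0.
Qed.

Section RootAdditive.
Variable f : {additive rat -> mulgrp L}.
Hypotheses (f1 : f 1 = 0)
  (fP : forall l, prime l -> l%:R != 0 :> L -> f l%:R^-1 != 0).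

(** With [q = a / b] in lowest terms and [l] a divisor of [b], the element
    [f (1 / l)] is killed by [l] and by [a], which are coprime. *)
Lemma root_additive_denq q l : f q = 0 -> prime l -> (l %| `|denq q|)%N -> l%:R = 0 :> L.
Proof.
move=> fq l_prime /dvdnP[d dE]; apply/eqP/contraT => /(fP l_prime)/eqP[].
have l0 : l%:R != 0 :> rat by rewrite pnatr_eq0 -lt0n prime_gt0.
apply: (@coprime_mulrn_eq0 _ _ l `|numq q|).
- exact: prime_gt0.
- rewrite coprime_sym; apply: coprime_dvdr (coprime_num_den q).
  by apply/dvdnP; exists d.
- by rewrite -raddfMn -[_ *+ _]mulr_natr mulVf.
- rewrite -[_ *+ _]/(_ *~ `|numq q|%N%:Z) abszEsg mulrC mulrzA.
  rewrite -(raddfMz f) (_ : _ *~ _ = q *+ d) ?raddfMn ?fq ?mul0rn ?mul0rz //.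
  rewrite -[LHS]mulrzl numqE -absz_denq dE -[RHS]mulr_natr -[_%:~R]/((d * l)%:R).
  by rewrite natrM mulrA mulfK.
Qed.

(** If [n] is nonzero in [L], the order [m] of [f (1 / n)] is [n]: a prime factor
    [l] of [n / m] would give [f (1 / l) = 0]. So all [n]-th roots of unity are
    powers of [f (1 / n)]. Otherwise injectivity of the Frobenius map removes a
    factor [p] from [n]. *)
Lemma root_additive_torsion (c : L) n : (0 < n)%N -> c ^+ n = 1 ->
  exists q, mulval (f q) = c.
Proof.
elim/ltn_ind: n => n IHn n_gt0 cn.
have [n0|n0] := eqVneq (n%:R : L) 0.
  have [l lL] := natf0_pchar n_gt0 (introT eqP n0).
  have : (l %| n)%N by rewrite (dvdn_pcharf lL) n0.
  have l_prime := pcharf_prime lL.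
  case/dvdnP=> m nE; have m_gt0 : (0 < m)%N by rewrite nE muln_gt0 in n_gt0; case/andP: n_gt0.
  apply: (IHn m) => //; first by rewrite nE ltn_Pmulr // prime_gt1.
  by apply: (fmorph_inj (pFrobenius_aut lL)); rewrite /= !pFrobenius_autE expr1n -exprM -nE.
pose z := mulval (f n%:R^-1).
have nq0 : (n%:R : rat) != 0 by rewrite pnatr_eq0 -lt0n.
have zn : z ^+ n = 1.
  by rewrite /z -mulvalMn -raddfMn -[_ *+ _]mulr_natr mulVf // f1.
have [m z_prim /dvdnP[d nE]] := prim_order_exists n_gt0 zn.
have d_gt0 : (0 < d)%N by rewrite nE muln_gt0 in n_gt0; case/andP: n_gt0.
have d1 : d = 1%N.
  apply/eqP/contraT => d_neq1.
  have l_prime : prime (pdiv d) by rewrite pdiv_prime // ltn_neqAle eq_sym d_neq1.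
  move: (pdiv d) l_prime (pdiv_dvd d) => l l_prime /dvdnP[d' dE].
  have l0 : l%:R != 0 :> L.
    by apply: contraNneq n0 => l0; rewrite nE dE !natrM l0 mulr0 mul0r.
  case/eqP: (fP l_prime l0); apply: mulval_inj; rewrite mulval0.
  have lq0 : (l%:R : rat) != 0 by rewrite pnatr_eq0 -lt0n prime_gt0.
  suff -> : l%:R^-1 = n%:R^-1 *+ (m * d') :> rat.
    by rewrite raddfMn mulvalMn exprM (prim_expr_order z_prim) expr1n.
  apply: (mulfI lq0); rewrite mulfV // -[n%:R^-1 *+ _]mulr_natr mulrCA -natrM.
  by rewrite (_ : (l * (m * d'))%N = n) ?mulVf // nE dE mulnCA mulnC (mulnC l).
rewrite {}d1 mul1n in nE; rewrite -nE in z_prim.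
have [i ->] := prim_rootP z_prim cn.
by exists (n%:R^-1 *+ i); rewrite raddfMn mulvalMn.
Qed.

Lemma root_additive_ker (p : nat) q : field_char p L ->
  f q = 0 <-> kernel_ring p q.
Proof.
move=> charL; split; last first.
  case: p charL => [|p] charL /= [m]; first by move->; rewrite (raddfMz f) f1 mul0rz.
  move=> [n ->]; elim: n m => [|n IHn] m.
    by rewrite expr0 divr1 (raddfMz f) f1 mul0rz.
  apply: (mulgrp_pchar_eq0 charL); rewrite -raddfMn -(IHn m); congr (f _).
  have p0 : (p.+1%:R : rat) != 0 by rewrite pnatr_eq0.
  by rewrite -[LHS]mulr_natr exprS invfM mulrCA mulrC mulVKf.
move=> fq; have den := root_additive_denq fq.
case: p charL => [|p] charL /=.
  exists (numq q); rewrite -{1}[q]divq_num_den; suff -> : denq q = 1 by rewrite divr1.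
  rewrite -absz_denq; congr Posz; apply/eqP/contraT => d1.
  have l_prime : prime (pdiv `|denq q|%N).
    by rewrite pdiv_prime // ltn_neqAle eq_sym d1 absz_gt0 denq_neq0.
  have := charL (pdiv `|denq q|%N); rewrite !inE l_prime /=.
  by rewrite (den _ l_prime (pdiv_dvd _)) eqxx.
have pn : (p.+1).-nat `|denq q|%N.
  apply/pnatP; first by rewrite absz_gt0 denq_neq0.
  move=> l l_prime /(den _ l_prime)/eqP l0.
  by rewrite -(pcharf_eq charL) inE l_prime.
have [n nE] := p_natP pn; exists (numq q), n.
by rewrite -natrX -nE -[_%:R]/((`|denq q|%N%:Z)%:~R) absz_denq divq_num_den.
Qed.

End RootAdditive.
End RootsOfUnity.

(** * The two structures *)

Lemma closed_field_of_char p : p = 0%N \/ prime p ->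
  exists L : closedFieldType, field_char p L.
Proof.
case=> [->|p_prime]; first by exists algC; apply: pchar_num.
have [L [iota _]] := countable_algebraic_closure ('F_p).
exists L; rewrite /field_char; case: p p_prime iota => // p p_prime iota.
by rewrite (fmorph_pchar iota) pchar_Fp.
Qed.

Section Cover.
Variable W : zmodType.

Definition rat_hom : {pred rat -> W} := fun u => `[< zmod_morphism u >].

Lemma rat_hom_zmod_closed : zmod_closed rat_hom.
Proof.
split=> [|u v /asboolP hu /asboolP hv]; apply/asboolP => q r; first by rewrite -[LHS]/0 subrr.
by rewrite -[LHS]/(u (q - r) - v (q - r)) hu hv opprD addrACA -opprD.
Qed.
HB.instance Definition _ := GRing.isZmodClosed.Build _ rat_hom rat_hom_zmod_closed.

Definition cover : zmodType := subg rat_hom.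

(** The evaluation pairing is named twice, as [cover_at] and as [cover_fun], to
    carry its additivity in each of the two variables. *)
Definition cover_at (q : rat) (u : cover) : W := val u q.

Lemma cover_at_is_zmod_morphism q : zmod_morphism (cover_at q).
Proof. by []. Qed.
HB.instance Definition _ q :=
  GRing.isZmodMorphism.Build cover W (cover_at q) (cover_at_is_zmod_morphism q).

Definition cover_fun (u : cover) (q : rat) : W := val u q.
Lemma cover_fun_is_zmod_morphism u : zmod_morphism (cover_fun u).
Proof. exact/asboolP/(valP u). Qed.
HB.instance Definition _ u :=
  GRing.isZmodMorphism.Build rat W (cover_fun u) (cover_fun_is_zmod_morphism u).

Lemma cover_of_additive (f : {additive rat -> W}) : exists u, cover_fun u =1 f.
Proof.
have fP : (f : rat -> W) \in rat_hom by apply/asboolP => q r; rewrite raddfB.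
by exists (Subg fP).
Qed.

Lemma cover_eq0 (u : cover) : cover_fun u =1 (fun=> 0) -> u = 0.
Proof. by move=> u0; apply/val_inj/funext. Qed.

Lemma cover_torsion_free : torsion_free cover.
Proof.
move=> n u n_gt0 un; apply: cover_eq0 => q.
have n0 : (n%:R : rat) != 0 by rewrite pnatr_eq0 -lt0n.
have -> : q = (q / n%:R) *+ n by rewrite -[RHS]mulr_natr divfK.
by rewrite raddfMn; have := congr1 (cover_at (q / n%:R)) un; rewrite raddfMn.
Qed.

Lemma cover_divisible : divisible cover.
Proof.
move=> n u n_gt0; have n0 : (n%:R : rat) != 0 by rewrite pnatr_eq0 -lt0n.
have [v vE] := cover_of_additive (cover_fun u \o (n%:R^-1 \*o idfun)).
exists v; apply/eqP; rewrite -subr_eq0; apply/eqP/cover_eq0 => q.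
rewrite -[LHS]/(cover_at q (v *+ n - u)) raddfB raddfMn /=.
rewrite (vE q : cover_at q v = _) /= -raddfMn mulrC -[_ / _ *+ _]mulr_natr divfK //.
exact: subrr.
Qed.

End Cover.

Lemma exists_standard_kernel p (L : closedFieldType) : field_char p L ->
  exists A : subE p, [/\ subS A, standard_kernel A & full_kernel A].
Proof.
move=> charL; have [f f1 fP] := root_additive L.
have tf : torsion_free rat.
  by move=> n q n_gt0 /eqP; rewrite mulrn_eq0 eqn0Ngt n_gt0 => /eqP.
exists (gen_subE charL tf (@divisible_numField _) f); split.
- exact: gen_subS.
- exists (gen (1 : rat)); first by apply: gen_transcendental; rewrite ?oner_eq0.
  have genE (q : rat) : gen q = gen 1 * ratr q.
    rewrite ratgenE -rmorphM; congr (FracField.tofrac _); apply: polyeval_inj => x.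
    rewrite rmorphM /polyeval /= -[q in LHS]mulr1 [RHS]mulrC.
    have lin_x : zmod_morphism (x : rat^o -> rat^o) by apply: raddfB.
    exact: (rat_linear lin_x q 1).
  move=> z; split=> [[a]|[r rker ->]].
    rewrite mem_gen_kernel => /eqP/(root_additive_ker f1 fP _ charL) aker <-.
    exists (of_image a) => //; rewrite -genE -[LHS]/(val a).
    by rewrite -[a in LHS](of_imageK a).
  exists (to_image r); last by rewrite -genE.
  rewrite mem_gen_kernel (to_imageK tf) ; apply/eqP.
  exact/(root_additive_ker f1 fP _ charL).
- by apply: gen_full_kernel => z n; apply: root_additive_torsion.
Qed.

Lemma exists_compact_kernel p (L : closedFieldType) : field_char p L ->
  exists A : subE p, [/\ subS A, compact_kernel A & full_kernel A].
Proof.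
move=> charL; pose W := mulgrp L; have divW := @divisible_mulgrp L.
pose tf := @cover_torsion_free W.
pose A := gen_subE charL tf (@cover_divisible W) (cover_at 1).
exists A; split; first exact: gen_subS.
- pose ev n (k : subg (kernel A)) : W := cover_at n`!%:R^-1 (of_image (val k)).
  have evB n : zmod_morphism (ev n).
    by move=> k k'; rewrite /ev raddfB (of_imageB tf) raddfB.
  pose evM n := GRing.isZmodMorphism.Build _ _ (ev n) (evB n).
  pose evA n := HB.pack_for {additive subg (kernel A) -> W} (ev n) (evM n).
  apply: (@towers_algebraically_compact _ _ evA divW).
  + by move=> k; exact: (tower_of_additive (cover_fun (of_image (val k)))).
  + move=> k /=; rewrite /ev fact0 invr1; have := valP k.
    by rewrite [_ \in _]mem_gen_kernel => /eqP.
  + move=> k /= k0; apply/val_inj; rewrite -[val k]of_imageK.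
    rewrite (_ : of_image _ = 0); first by apply: val_inj; exact: (raddf0 gen).
    exact/cover_eq0/additive_rat_eq0.
  + move=> z tz z0; have [f fz] := additive_of_tower divW tz.
    have [u uf] := cover_of_additive f.
    have ku : (to_image u : carrier A) \in kernel A.
      rewrite mem_gen_kernel (to_imageK tf); apply/eqP; rewrite -z0 -fz fact0 invr1.
      exact: uf.
    exists (Subg ku) => n; by rewrite /= /ev /= (to_imageK tf) -fz -uf.
- apply: gen_full_kernel => z n n_gt0 zn; have [f f1 fP] := root_additive L.
  have [q <-] := root_additive_torsion f1 fP n_gt0 zn.
  (* Precompose [f] with the multiplication by [q]. *)
  pose g : {additive rat -> W} := f \o (q \*o idfun).
  have [u uE] := cover_of_additive g; exists u.
  by congr mulval; apply: etrans (uE 1) _; rewrite /= mulr1.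
Qed.

Local Close Scope ring_scope.

Theorem proposition1 (p : nat) (hp : p = 0 \/ prime p) :
  (exists A : subE p, [/\ subS A, standard_kernel A & full_kernel A]) /\
  (exists A : subE p, [/\ subS A, compact_kernel A & full_kernel A]).
Proof.
have [L charL] := closed_field_of_char hp.
split; [exact: exists_standard_kernel charL | exact: exists_compact_kernel charL].
Qed.
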